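(* Let $K$ be a field and let $n_1,n_2\ge 1$ be integers. Then the join-meet ideal $I_{L_2(n_1,n_2)}\subset K[L_2(n_1,n_2)]$ is a radical ideal.
   Context: For a finite lattice $L$ and a field $K$, $K[L]$ denotes the polynomial ring over $K$ whose variables $x_a$ are indexed by the elements $a\in L$. The join-meet ideal of $L$ is $I_L=(\{x_ax_b-x_{a\vee b}x_{a\wedge b}\mid a,b\in L\})\subset K[L]$. For integers $n_1,n_2\ge 1$, $L_2(n_1,n_2)=\{s,a_1,\dots,a_{n_1},b_1,\dots,b_{n_2},t\}$ is the finite lattice with $n_1+n_2+2$ distinct elements whose order is generated by $s<a_1<a_2<\cdots<a_{n_1}<t$ and $s<b_1<b_2<\cdots<b_{n_2}<t$; thus every $a_i$ is incomparable to every $b_j$, with $a_i\vee b_j=t$ and $a_i\wedge b_j=s$. *)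

(* Defs.v *)
From HB Require Import structures.
From mathcomp Require Import all_boot all_order all_algebra.
From mathcomp Require Import mpoly.

Set Implicit Arguments.
Unset Strict Implicit.
Unset Printing Implicit Defensive.

Import Order.TTheory GRing.Theory.

Local Open Scope ring_scope.

(* The ideals of MathComp (ring_quotient) are proper and boolean-valued; here
   ideals are arbitrary Prop-valued predicates and may be the whole ring. *)

Section Ideals.
Variable R : comNzRingType.
Implicit Types (G I : R -> Prop) (f g h : R).

Definition is_ideal I : Prop :=
  [/\ I 0,
      forall f g, I f -> I g -> I (f + g)
    & forall h f, I f -> I (h * f)].

Definition ideal_gen G f : Prop :=
  exists (m : nat) (c g : 'I_m -> R),
    (forall i, G (g i)) /\ f = \sum_(i < m) c i * g i.

Definition radical I f : Prop := exists2 m : nat, (0 < m)%N & I (f ^+ m).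

Definition is_radical_ideal I : Prop :=
  is_ideal I /\ forall f, radical I f <-> I f.

End Ideals.

Section JoinMeetIdeal.
Variables (K : fieldType) (d : Order.disp_t) (L : finLatticeType d).

(* The variables of {mpoly K[n]} are indexed by 'I_n, so the elements of L are
   numbered by enum_rank : L -> 'I_#|L|. *)
Definition lattice_poly := {mpoly K[#|L|]}.

Definition lvar (a : L) : lattice_poly := 'X_(enum_rank a).

Definition join_meet_gen (f : lattice_poly) : Prop :=
  exists a b : L,
    f = lvar a * lvar b - lvar (Order.join a b) * lvar (Order.meet a b).

Definition join_meet_ideal : lattice_poly -> Prop := ideal_gen join_meet_gen.

End JoinMeetIdeal.

Arguments lvar K {d L} a.
Arguments join_meet_ideal K {d} L f.

(* L2a i and L2b j stand for a_(i+1) and b_(j+1): ordinals start at 0. *)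
Inductive L2 (n1 n2 : nat) : Type :=
  L2s | L2a of 'I_n1 | L2b of 'I_n2 | L2t.

Arguments L2s {n1 n2}.
Arguments L2a {n1 n2} i.
Arguments L2b {n1 n2} j.
Arguments L2t {n1 n2}.

Section L2Lattice.
Variables n1 n2 : nat.
Local Notation T := (L2 n1 n2).
Implicit Types x y z : T.

Definition L2_code x : option (option ('I_n1 + 'I_n2)) :=
  match x with
  | L2s => None
  | L2t => Some None
  | L2a i => Some (Some (inl i))
  | L2b j => Some (Some (inr j))
  end.

Definition L2_decode (c : option (option ('I_n1 + 'I_n2))) : T :=
  match c with
  | None => L2s
  | Some None => L2t
  | Some (Some (inl i)) => L2a i
  | Some (Some (inr j)) => L2b j
  end.

Lemma L2_codeK : cancel L2_code L2_decode.
Proof. by case. Qed.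

HB.instance Definition _ := Finite.copy T (can_type L2_codeK).

Definition L2_le x y : bool :=
  match x, y with
  | L2s, _ | _, L2t => true
  | L2a i, L2a j => (i <= j)%N
  | L2b i, L2b j => (i <= j)%N
  | _, _ => false
  end.

Definition L2_meet x y : T :=
  if L2_le x y then x else if L2_le y x then y else L2s.

Definition L2_join x y : T :=
  if L2_le x y then y else if L2_le y x then x else L2t.

Fact L2_le_refl : reflexive L2_le.
Proof. by case=> //= i; apply: leqnn. Qed.

Fact L2_le_anti : antisymmetric L2_le.
Proof.
by case=> [|i|i|] [|j|j|] //= h; congr (_ _); apply/val_inj/anti_leq.
Qed.

Fact L2_le_trans : transitive L2_le.
Proof.
by move=> y x z; case: y x z => [|j|j|] [|i|i|] [|k|k|] //=; apply: leq_trans.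
Qed.

Fact L2_lexI x y z : L2_le x (L2_meet y z) = L2_le x y && L2_le x z.
Proof.
rewrite /L2_meet; case yz: (L2_le y z).
  by case xy: (L2_le x y) => //=; rewrite (L2_le_trans xy yz).
case zy: (L2_le z y).
  by case xz: (L2_le x z); rewrite ?andbF // (L2_le_trans xz zy).
by case: x y z yz zy => [|i|i|] [|j|j|] [|k|k|] //=; rewrite ?andbF //;
  case: leqP => // /ltnW ->.
Qed.

Fact L2_leUx x y z : L2_le (L2_join x y) z = L2_le x z && L2_le y z.
Proof.
rewrite /L2_join; case xy: (L2_le x y).
  by case yz: (L2_le y z); rewrite ?andbF // (L2_le_trans xy yz).
case yx: (L2_le y x).
  by case xz: (L2_le x z); rewrite //= (L2_le_trans yx xz).
by case: x y z xy yx => [|i|i|] [|j|j|] [|k|k|] //=; rewrite ?andbF //;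
  case: leqP => // /ltnW ->.
Qed.

End L2Lattice.

Fact L2_display : Order.disp_t.
Proof. exact: Order.Disp tt tt. Qed.

HB.instance Definition _ (n1 n2 : nat) :=
  Order.Le_isPOrder.Build L2_display (L2 n1 n2)
    (@L2_le_refl n1 n2) (@L2_le_anti n1 n2) (@L2_le_trans n1 n2).

HB.instance Definition _ (n1 n2 : nat) :=
  Order.POrder_MeetJoin_isLattice.Build L2_display (L2 n1 n2)
    (@L2_lexI n1 n2) (@L2_leUx n1 n2).

Definition L2_chain_rel (n1 n2 : nat) : rel (L2 n1 n2) := fun x y =>
  match x, y with
  | L2s, L2a i => i == 0%N :> nat
  | L2a i, L2a j => j == i.+1 :> nat
  | L2a i, L2t => i.+1 == n1
  | L2s, L2b i => i == 0%N :> nat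
  | L2b i, L2b j => j == i.+1 :> nat
  | L2b i, L2t => i.+1 == n2
  | _, _ => false
  end.

Section L2Order.
Variables n1 n2 : nat.
Hypotheses (n1_gt0 : (1 <= n1)%N) (n2_gt0 : (1 <= n2)%N).
Implicit Types x y : L2 n1 n2.

(* The order of L2 is the one generated by the two chains
   s < a_1 < ... < a_n1 < t and s < b_1 < ... < b_n2 < t. *)
Lemma L2_le_generated x y : (x <= y)%O = connect (@L2_chain_rel n1 n2) x y.
Proof.
apply/idP/idP; last first.
  case/connectP=> p; elim: p x => [|z p IHp] x /=; first by move=> _ ->.
  case/andP=> xz pz ey; apply: le_trans (IHp z pz ey).
  by case: x z xz {pz ey} => [|i|i|] [|j|j|] //= /eqP e; rewrite /Order.le /= e.
have up_a (i j : 'I_n1) : (i <= j)%N ->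
    connect (@L2_chain_rel n1 n2) (L2a i) (L2a j).
  case: j => j; elim: j => [|j IHj] ltj le_ij.
    by rewrite (_ : i = Ordinal ltj) //; apply/val_inj/eqP; rewrite -leqn0.
  move: le_ij; rewrite leq_eqVlt => /orP[/eqP e|lt_ij].
    by rewrite (_ : i = Ordinal ltj) //; apply/val_inj.
  apply: connect_trans (IHj (ltnW ltj) lt_ij) (connect1 _).
  by rewrite /= eqxx.
have up_b (i j : 'I_n2) : (i <= j)%N ->
    connect (@L2_chain_rel n1 n2) (L2b i) (L2b j).
  case: j => j; elim: j => [|j IHj] ltj le_ij.
    by rewrite (_ : i = Ordinal ltj) //; apply/val_inj/eqP; rewrite -leqn0.
  move: le_ij; rewrite leq_eqVlt => /orP[/eqP e|lt_ij].
    by rewrite (_ : i = Ordinal ltj) //; apply/val_inj.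
  apply: connect_trans (IHj (ltnW ltj) lt_ij) (connect1 _).
  by rewrite /= eqxx.
have s_a (i : 'I_n1) : connect (@L2_chain_rel n1 n2) L2s (L2a i).
  by apply: connect_trans (connect1 _) (up_a (Ordinal n1_gt0) i (leq0n i)).
have s_b (i : 'I_n2) : connect (@L2_chain_rel n1 n2) L2s (L2b i).
  by apply: connect_trans (connect1 _) (up_b (Ordinal n2_gt0) i (leq0n i)).
have a_t (i : 'I_n1) : connect (@L2_chain_rel n1 n2) (L2a i) L2t.
  have lt1 : (n1.-1 < n1)%N by rewrite prednK.
  apply: connect_trans (up_a i (Ordinal lt1) _) (connect1 _) => /=.
    by rewrite -ltnS prednK.
  by rewrite prednK.
have b_t (i : 'I_n2) : connect (@L2_chain_rel n1 n2) (L2b i) L2t.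
  have lt2 : (n2.-1 < n2)%N by rewrite prednK.
  apply: connect_trans (up_b i (Ordinal lt2) _) (connect1 _) => /=.
    by rewrite -ltnS prednK.
  by rewrite prednK.
case: x y => [|i|i|] [|j|j|] //= le_xy; try exact: connect0; auto.
exact: connect_trans (s_a (Ordinal n1_gt0)) (a_t _).
Qed.

End L2Order.

(* Main.v *)
From HB Require Import structures.
Require Import Defs.
From mathcomp Require Import all_boot all_order all_algebra.
From mathcomp Require Import mpoly ring.

Set Implicit Arguments.
Unset Strict Implicit.
Unset Printing Implicit Defensive.

Import Order.TTheory GRing.Theory.

Local Open Scope ring_scope.

(** Write q for a_0 b_0 - s t, where a_0 and b_0 are one variable of each
    chain, and I for the ideal of all a_i b_j - s t.  Geometrically, the zero
    set of I is the quadric q = 0 in the linear space where all a_i coincide and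
    all b_j coincide, together with the linear spaces where all b_j vanish and
    s t = 0, and those where all a_i vanish and s t = 0.  The proof compares a
    polynomial f with a power in I to its images on these three pieces.

    The first piece is seen by the substitution [merge], which sends every a_i
    to a_0 and every b_j to b_0 and carries I into (q); the other two by the
    substitutions [kill B] and [kill A], which set all b_j, respectively all
    a_i, to 0 and carry I into (s t).  Both principal ideals are radical, since
    a polynomial with squarefree leading monomial generates a radical ideal
    ([multiples_radical]).  So merge f is a multiple of q, hence lies in I, and
    it remains to treat g = f - merge f, which merge sends to 0.

    The kernel of merge is generated by the differences a_i - a_0 and b_j - b_0.
    Modulo I the product of a_i - a_k with any b_j is 0, and likewise for
    b_j - b_l and any a_i.  Therefore g is congruent to kill B g + kill A g
    modulo I ([kill_split]).  Each of these terms is of the form s t k, because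
    some power of g is in I; moreover merge sends s t k to 0, hence k to 0,
    so k is a combination of differences.  Finally s t times a difference is in
    I ([st_sub_rep]), so both terms, and g, are in I ([cross_radical]). *)

(** * Ideals given by generators *)

Section IdealGen.
Variable R : comNzRingType.
Implicit Types (G J P : R -> Prop) (f g h w : R).

(** Unlike [ideal_gen_sub], this induction applies to predicates that are closed
    under addition but need not be ideals. *)
Lemma ideal_gen_ind G P :
    P 0 -> (forall f g, P f -> P g -> P (f + g)) ->
    (forall c g, G g -> P (c * g)) ->
  forall f, ideal_gen G f -> P f.
Proof.
move=> P0 PD PM f [m [c [g [Gg ->]]]].
by apply: (big_ind P) => // i _; apply: PM.
Qed.

Lemma ideal_gen_in G g : G g -> ideal_gen G g.
Proof.
by move=> Gg; exists 1, (fun=> 1), (fun=> g); rewrite big_ord1 mul1r.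
Qed.

Lemma ideal_genP G : is_ideal (ideal_gen G).
Proof.
split.
- by exists 0, (fun=> 0), (fun=> 0); split=> [[]|] //; rewrite big_ord0.
- move=> _ _ [m1 [c1 [g1 [G1 ->]]]] [m2 [c2 [g2 [G2 ->]]]].
  (* The coefficients and generators of the two sums are concatenated. *)
  pose glue (u : 'I_m1 -> R) (v : 'I_m2 -> R) i :=
    match split i with inl j => u j | inr j => v j end.
  exists (m1 + m2)%N, (glue c1 c2), (glue g1 g2); split=> [i|].
    by rewrite /glue; case: (split i).
  rewrite big_split_ord /=; congr (_ + _); apply: eq_bigr => i _.
    by rewrite /glue -[lshift _ _]/(unsplit (inl i)) unsplitK.
  by rewrite /glue -[rshift _ _]/(unsplit (inr i)) unsplitK.
- move=> h _ [m [c [g [Gg ->]]]]; exists m, (fun i => h * c i), g; split=> //.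
  by rewrite mulr_sumr; apply: eq_bigr => i _; rewrite mulrA.
Qed.

Lemma ideal_gen_sub G J :
  is_ideal J -> (forall g, G g -> J g) -> forall f, ideal_gen G f -> J f.
Proof.
by move=> [J0 JD JM] GJ; apply: ideal_gen_ind => // c g Gg; apply/JM/GJ.
Qed.

Lemma idealN J f : is_ideal J -> J f -> J (- f).
Proof. by move=> [_ _ JM] Jf; rewrite -mulN1r; apply: JM. Qed.

Lemma idealB J f g : is_ideal J -> J f -> J g -> J (f - g).
Proof.
by move=> idJ Jf /(idealN idJ) Jg; case: idJ => _ JD _; apply: JD.
Qed.

Definition multiples q f : Prop := exists h, f = h * q.

Lemma multiples_ideal q : is_ideal (multiples q).
Proof.
split; first by exists 0; rewrite mul0r.
- by move=> _ _ [h1 ->] [h2 ->]; exists (h1 + h2); rewrite mulrDl.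
- by move=> h _ [k ->]; exists (h * k); rewrite mulrA.
Qed.

(** f - g divides f ^+ m - g ^+ m. *)
Lemma radical_eqmod J f g m :
  is_ideal J -> J (f - g) -> J (f ^+ m) -> J (g ^+ m).
Proof.
move=> idJ Jfg Jf; rewrite -[_ ^+ m](subKr (f ^+ m)); apply: idealB => //.
by case: idJ => _ _ JM; rewrite subrXX mulrC; apply: JM.
Qed.

End IdealGen.

Section PreimIdeal.
Variables (R S : comNzRingType) (phi : {rmorphism R -> S}).

Lemma ideal_gen_morph (G : R -> Prop) (J : S -> Prop) :
    is_ideal J -> (forall g, G g -> J (phi g)) ->
  forall f, ideal_gen G f -> J (phi f).
Proof.
move=> [J0 JD JM] GJ; apply: ideal_gen_ind; first by rewrite rmorph0.
  by move=> f g; rewrite rmorphD; apply: JD.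
by move=> c g /GJ Jg; rewrite rmorphM; apply: JM.
Qed.

End PreimIdeal.

(** * Substitutions and leading monomials *)

Section Substitution.
Variables (K : fieldType) (n : nat).
Local Notation R := {mpoly K[n]}.
Implicit Types (p q f g h : R).

Lemma mpoly_ringind (P : R -> Prop) :
    (forall c, P c%:MP) -> (forall i, P 'X_i) ->
    (forall p q, P p -> P q -> P (p + q)) ->
    (forall p q, P p -> P q -> P (p * q)) ->
  forall p, P p.
Proof.
move=> PC PX PD PM; apply: mpolyind => [|c m p _ _ Pp].
  by rewrite -mpolyC0; apply: PC.
apply: (PD) => //; rewrite -mul_mpolyC mpolyXE_id; apply: (PM) => //.
have P1 : P 1 by rewrite -mpolyC1; apply: PC.
apply: (big_ind P) => // i _.
by elim: (m i) => [|k IHk]; rewrite ?expr0 // exprS; apply: PM.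
Qed.

Lemma eq_mpoly_morph (S : comNzRingType) (phi psi : {rmorphism R -> S}) :
    (forall c, phi c%:MP = psi c%:MP) -> (forall i, phi 'X_i = psi 'X_i) ->
  phi =1 psi.
Proof.
move=> eC eX; apply: mpoly_ringind => // p q ep eq.
  by rewrite !rmorphD ep eq.
by rewrite !rmorphM ep eq.
Qed.

Definition subst (s : 'I_n -> R) : R -> R := mmap (@mpolyC n K) s.

HB.instance Definition _ s := GRing.RMorphism.on (subst s).

Lemma substC s c : subst s c%:MP = c%:MP.
Proof. exact: mmapC. Qed.

Lemma substX s i : subst s 'X_i = s i.
Proof. by rewrite /subst mmapX mmap1U. Qed.

(** Modulo J, the substitution s is the identity on variables, hence on the ring
    they generate. *)
Lemma subst_eqmod J s :
  is_ideal J -> (forall i, J ('X_i - s i)) -> forall f, J (f - subst s f).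
Proof.
move=> [J0 JD JM] JX; apply: mpoly_ringind => [c|i|p q Jp Jq|p q Jp Jq].
- by rewrite substC subrr.
- by rewrite substX.
- by rewrite rmorphD opprD addrACA; apply: JD.
- have -> : p * q - subst s (p * q)
    = q * (p - subst s p) + subst s p * (q - subst s q).
    by rewrite rmorphM !mulrBr (mulrC q p) (mulrC q) addrA subrK.
  by apply: JD; apply: JM.
Qed.

(** If q divides f ^+ m, the leading monomial of q divides that of f ^+ m, that
    is, the m-th power of the leading monomial of f; being squarefree, it already
    divides the leading monomial of f.  One division step then replaces f by a congruent
    polynomial with a smaller leading monomial. *)
Lemma multiples_radical q f m :
    q != 0 -> (forall i, mlead q i <= 1)%N ->
  multiples q (f ^+ m) -> multiples q f.
Proof.
move=> q0 sqfree; elim/mleadrect: f => f IHf fm.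
have [->|f0] := eqVneq f 0; first by exists 0; rewrite mul0r.
have le_lead : (mlead q <= mlead f)%MM.
  apply/mnm_lepP => i; have [h eh] := fm.
  have h0 : h != 0.
    apply: contraTneq (expf_neq0 m f0) => h0.
    by rewrite eh h0 mul0r eqxx.
  have := congr1 (fun p => mlead p i) eh.
  rewrite /= mleadX // mleadM // mnmDE mulmnE.
  have := sqfree i; case: (mlead q i) => [|[|//]] _ //.
  by case: (mlead f i) => //; rewrite mul0n addn1.
pose x := (mleadc f / mleadc q) *: 'X_[(mlead f - mlead q)].
have lcq : mleadc q != 0 by rewrite mleadc_eq0.
have lcx : mleadc f / mleadc q != 0.
  by rewrite mulf_neq0 ?invr_eq0 // mleadc_eq0.
have lx : mlead x = (mlead f - mlead q)%MM by rewrite mleadZ // mleadXm.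
have x0 : x != 0 by rewrite scaler_eq0 negb_or lcx -msupp_eq0 msuppX.
have lxq : mlead (x * q) = mlead f by rewrite mleadM // lx submK.
have xq : multiples q (x * q) by exists x.
have idq := multiples_ideal q.
suff [h eh] : multiples q (f - x * q).
  by exists (h + x); rewrite mulrDl -eh subrK.
(* A constant f has the same leading monomial as 0, so the division may leave 0
   without lowering the leading monomial. *)
have [->|f'0] := eqVneq (f - x * q) 0; first by exists 0; rewrite mul0r.
apply: IHf; last first.
  by apply: radical_eqmod fm; rewrite // subKr.
rewrite lt_neqAle; apply/andP; split.
  apply: contraNneq f'0 => e; rewrite -mleadc_eq0 e mcoeffB -{2}lxq.
  rewrite mleadM // mleadcM lx /x mcoeffZ mcoeffX eqxx mulr1.
  by rewrite divfK // subrr.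
by apply: le_trans (mleadB_le _ _) _; rewrite lxq joinxx.
Qed.

Lemma mnm_pair_squarefree (i j : 'I_n) : i != j ->
  forall k, ((U_(i) + U_(j))%MM k <= 1)%N.
Proof.
move=> ij k; rewrite mnmDE !mnm1E.
have [<-|_] := eqVneq i k; last by case: (j == k).
by rewrite eq_sym (negPf ij).
Qed.

End Substitution.

(** * The ideal of two families of variables with all cross products equal *)

Section CrossIdeal.
Variables (K : fieldType) (n : nat) (A B : pred 'I_n) (s t a0 b0 : 'I_n).
Hypotheses (AB : forall i, A i -> B i = false).
Hypotheses (sA : A s = false) (sB : B s = false).
Hypotheses (tA : A t = false) (tB : B t = false).
Hypotheses (neq_st : s != t) (Aa0 : A a0) (Bb0 : B b0).
Local Notation R := {mpoly K[n]}.
Implicit Types (f g h : R) (S : pred 'I_n).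

Definition cross (a b : 'I_n) : R := 'X_a * 'X_b - 'X_s * 'X_t.

Definition cross_gen f : Prop :=
  exists a b, [/\ A a, B b & f = cross a b].

Local Notation I := (ideal_gen cross_gen).

Lemma cross_ideal : is_ideal I. Proof. exact: ideal_genP. Qed.
Local Hint Resolve cross_ideal : core.

Lemma cross_in a b : A a -> B b -> I (cross a b).
Proof. by move=> Aa Bb; apply: ideal_gen_in; exists a, b. Qed.

Definition rep i := if A i then a0 else if B i then b0 else i.

Definition merge : R -> R := subst (fun i => 'X_(rep i)).
HB.instance Definition _ := GRing.RMorphism.on merge.

Definition kill S : R -> R := subst (fun i => if S i then 0 else 'X_i).
HB.instance Definition _ S := GRing.RMorphism.on (kill S).

Lemma mergeC c : merge c%:MP = c%:MP. Proof. exact: substC. Qed.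

Lemma killC S c : kill S c%:MP = c%:MP. Proof. exact: substC. Qed.

Lemma mergeX i : merge 'X_i = 'X_(rep i). Proof. exact: substX. Qed.

Lemma killX S i : kill S 'X_i = if S i then 0 else 'X_i.
Proof. exact: substX. Qed.

Lemma rep_s : rep s = s. Proof. by rewrite /rep sA sB. Qed.
Lemma rep_t : rep t = t. Proof. by rewrite /rep tA tB. Qed.

Lemma BA i : B i -> A i = false.
Proof. by move=> Bi; apply/negP => /AB; rewrite Bi. Qed.

Lemma A_rep i : A (rep i) = A i.
Proof.
rewrite /rep; case Ai: (A i); first by rewrite Aa0.
by case Bi: (B i) => //; rewrite (BA Bb0).
Qed.

Lemma B_rep i : B (rep i) = B i.
Proof.
rewrite /rep; case Ai: (A i); first by rewrite (AB Ai) (AB Aa0).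
by case Bi: (B i) => //; rewrite Bb0.
Qed.

Lemma rep_idem i : rep (rep i) = rep i.
Proof.
by rewrite {1}/rep A_rep B_rep /rep; case: (A i) => //; case: (B i).
Qed.

Lemma merge_idem f : merge (merge f) = merge f.
Proof.
apply: (eq_mpoly_morph (phi := merge \o merge) (psi := merge)) f => [c|i] /=.
  by rewrite !mergeC.
by rewrite !mergeX rep_idem.
Qed.

Lemma merge_cross a b : A a -> B b -> merge (cross a b) = cross a0 b0.
Proof.
move=> Aa Bb; rewrite rmorphB !rmorphM /= !mergeX rep_s rep_t.
by rewrite /rep Aa (BA Bb) Bb.
Qed.

Lemma cross_sub_l a a' b : A a -> A a' -> B b -> I (('X_a - 'X_a') * 'X_b).
Proof.
move=> Aa Aa' Bb.
have -> : ('X_a - 'X_a') * 'X_b = cross a b - cross a' b.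
  by rewrite /cross; ring.
by apply: idealB => //; apply: cross_in.
Qed.

Lemma cross_sub_r a b b' : A a -> B b -> B b' -> I (('X_b - 'X_b') * 'X_a).
Proof.
move=> Aa Bb Bb'.
have -> : ('X_b - 'X_b') * 'X_a = cross a b - cross a b'.
  by rewrite /cross; ring.
by apply: idealB => //; apply: cross_in.
Qed.

(** For d = a_i - a_0 both d b_0 and a_0 b_0 - s t are in I, and
    s t d = a_0 (d b_0) - d (a_0 b_0 - s t); the case d = b_j - b_0 is
    similar. *)
Lemma st_sub_rep i : I ('X_s * 'X_t * ('X_i - 'X_(rep i))).
Proof.
have [_ _ IM] := cross_ideal.
have -> : 'X_s * 'X_t * ('X_i - 'X_(rep i)) =
  'X_a0 * (('X_i - 'X_(rep i)) * 'X_b0) - ('X_i - 'X_(rep i)) * cross a0 b0.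
  by rewrite /cross; ring.
apply: idealB => //; last by apply/IM/cross_in.
have [Ai|nAi] := boolP (A i).
  by apply: IM; apply: cross_sub_l; rewrite // A_rep.
have [Bi|nBi] := boolP (B i).
  rewrite mulrCA mulrA (mulrC _ 'X_b0); apply: IM.
  by apply: cross_sub_r; rewrite // B_rep.
rewrite /rep (negPf nAi) (negPf nBi) subrr mul0r mulr0.
by case: cross_ideal.
Qed.

(** These differences generate the kernel of [merge]. *)
Definition rep_gen f : Prop := exists i, f = 'X_i - 'X_(rep i).

Lemma sub_merge_in f : ideal_gen rep_gen (f - merge f).
Proof.
apply: subst_eqmod; first exact: ideal_genP.
by move=> i; apply: ideal_gen_in; exists i.
Qed.

Lemma st_merge_ker h : merge h = 0 -> I ('X_s * 'X_t * h).
Proof.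
move=> h0; have := sub_merge_in h; rewrite h0 subr0.
have [I0 ID IM] := cross_ideal.
apply: (@ideal_gen_ind _ _ (fun h => I ('X_s * 'X_t * h))).
- by rewrite mulr0.
- by move=> f g If Ig; rewrite mulrDr; apply: ID.
- by move=> c _ [i ->]; rewrite mulrCA; apply/IM/st_sub_rep.
Qed.

Lemma kill_merge S :
  (forall i, S (rep i) = S i) -> forall f, kill S (merge f) = merge (kill S f).
Proof.
move=> Srep; apply: (eq_mpoly_morph (phi := kill S \o merge)
                                    (psi := merge \o kill S)) => [c|i] /=.
  by rewrite !(mergeC, killC).
rewrite mergeX !killX Srep; case: (S i); first by rewrite rmorph0.
by rewrite mergeX.
Qed.

(** It suffices to treat c * d with d = a_i - a_0 or d = b_j - b_0.  In the first
    case [kill A] sends d to 0 and [kill B] fixes it, and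
    c * d - kill B (c * d) = d * (c - kill B c) is in I because d annihilates
    every b_j modulo I, while c - kill B c is a combination of the b_j.  The
    second case exchanges the two families. *)
Lemma kill_split f : merge f = 0 -> I (f - kill A f - kill B f).
Proof.
move=> f0; have := sub_merge_in f; rewrite f0 subr0.
have [I0 ID IM] := cross_ideal.
apply: (@ideal_gen_ind _ _ (fun h => I (h - kill A h - kill B h))).
- by rewrite !rmorph0 !subr0.
- move=> g h Ig Ih; have := ID _ _ Ig Ih; congr I.
  by rewrite !rmorphD /=; ring.
- move=> c _ [i ->].
  have multI w S : (forall j, S j -> I (w * 'X_j)) -> I (w * (c - kill S c)).
    move=> wS.
    apply: (@subst_eqmod _ _ (fun p => I (w * p))); last first.
      move=> j; case Sj: (S j); rewrite ?subr0 ?subrr ?mulr0 //; exact: wS.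
    split=> [|p q Ip Iq|p q Iq]; first by rewrite mulr0.
      by rewrite mulrDr; apply: ID.
    by rewrite mulrCA; apply: IM.
  rewrite !rmorphM !rmorphB /= !killX A_rep B_rep.
  have [Ai|nAi] := boolP (A i).
    rewrite (AB Ai) subrr mulr0 subr0 -mulrBl mulrC.
    by apply: multI => j Bj; apply: cross_sub_l; rewrite // A_rep.
  have [Bi|nBi] := boolP (B i).
    rewrite subrr mulr0 subr0 -mulrBl mulrC.
    by apply: multI => j Aj; apply: cross_sub_r; rewrite // B_rep.
  by rewrite /rep (negPf nAi) (negPf nBi) subrr !mulr0 !subr0.
Qed.

Lemma neq0_ab : a0 != b0.
Proof. by apply: contraTneq Aa0 => ->; rewrite (BA Bb0). Qed.

Lemma st_neq0 : 'X_s * 'X_t != 0 :> R.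
Proof. by rewrite -mpolyXD -msupp_eq0 msuppX. Qed.

Lemma multiples_st_radical f m :
  multiples ('X_s * 'X_t) (f ^+ m) -> multiples ('X_s * 'X_t) f.
Proof.
apply: multiples_radical; first exact: st_neq0.
by rewrite -mpolyXD mleadXm; apply: mnm_pair_squarefree.
Qed.

Lemma kill_cross S a b :
    (forall i, S i -> A i || B i) -> S a || S b ->
  kill S (cross a b) = - ('X_s * 'X_t).
Proof.
move=> SAB Sab; have Ss : S s = false by apply/negP => /SAB; rewrite sA sB.
have St : S t = false by apply/negP => /SAB; rewrite tA tB.
rewrite rmorphB !rmorphM /= !killX Ss St.
by case/orP: Sab => ->; rewrite ?mulr0 ?mul0r sub0r.
Qed.

Lemma cross_neq0 : cross a0 b0 != 0.
Proof.
apply: contra_neq st_neq0 => q0; apply/eqP.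
have := @kill_cross A a0 b0; rewrite Aa0 q0 rmorph0 => e.
by rewrite -oppr_eq0 -e ?eqxx // => i ->.
Qed.

(** Both monomials of a_0 b_0 - s t are squarefree, hence so is the leading one. *)
Lemma multiples_cross_radical f m :
  multiples (cross a0 b0) (f ^+ m) -> multiples (cross a0 b0) f.
Proof.
apply: multiples_radical; first exact: cross_neq0.
have := mlead_supp cross_neq0; rewrite /cross -!mpolyXD => /msuppB_le.
rewrite mem_cat !msuppX !inE => /orP[] /eqP ->; apply: mnm_pair_squarefree => //.
exact: neq0_ab.
Qed.

(** Used for S = A and S = B: as S meets every pair (a, b) and avoids s and t,
    [kill S] sends each generator of I to - s t. *)
Lemma multiples_st_kill S f m :
    (forall i, S i -> A i || B i) ->
    (forall a b, A a -> B b -> S a || S b) ->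
    I (f ^+ m) ->
  multiples ('X_s * 'X_t) (kill S f).
Proof.
move=> SAB Sab Im; apply: (@multiples_st_radical _ m); rewrite -rmorphXn.
apply: (ideal_gen_morph (phi := kill S)) Im; first exact: multiples_ideal.
move=> _ [a [b [Aa Bb ->]]]; rewrite /= kill_cross //; last exact: Sab.
by exists (-1); rewrite mulN1r.
Qed.

Lemma cross_radical f m : I (f ^+ m) -> I f.
Proof.
move=> fm; have [I0 ID IM] := cross_ideal.
have [h eh] : multiples (cross a0 b0) (merge f).
  apply: (@multiples_cross_radical _ m); rewrite -rmorphXn.
  apply: (ideal_gen_morph (phi := merge)) fm; first exact: multiples_ideal.
  by move=> _ [a [b [Aa Bb ->]]]; exists 1; rewrite mul1r /= merge_cross.
pose g := f - merge f.
have Imf : I (merge f) by rewrite eh; apply/IM/cross_in.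
suff Ig : I g by rewrite -[f](subrK (merge f)); apply: ID.
have Igm : I (g ^+ m) by apply: radical_eqmod fm; rewrite // subKr.
have g0 : merge g = 0 by rewrite rmorphB /= merge_idem subrr.
have killI S : (forall i, S i -> A i || B i) ->
    (forall a b, A a -> B b -> S a || S b) ->
    (forall i, S (rep i) = S i) -> I (kill S g).
  move=> SAB Sab Srep; have [k ek] := multiples_st_kill SAB Sab Igm.
  (* The polynomial ring is a domain, so merge (k s t) = 0 gives merge k = 0. *)
  rewrite ek mulrC; apply: st_merge_ker.
  apply: (mulIf st_neq0); rewrite mul0r.
  have := congr1 merge ek; rewrite -kill_merge // g0 rmorph0.
  by rewrite !rmorphM /= !mergeX rep_s rep_t => <-.
have IA : I (kill A g).
  by apply: killI; [move=> i -> | move=> a b -> | exact: A_rep].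
have IB : I (kill B g).
  by apply: killI; [move=> i ->; rewrite orbT | move=> a b _ ->; rewrite orbT
    | exact: B_rep].
rewrite -[g](subrK (kill A g)); apply: (ID) => //.
rewrite -[g - _](subrK (kill B g)); apply: (ID) => //.
exact: kill_split.
Qed.

End CrossIdeal.

(** * The lattice with two chains *)

Section L2.
Variables (K : fieldType) (n1 n2 : nat).
Local Notation L := (L2 n1 n2).

Definition in_a (i : 'I_#|{: L}|) := if enum_val i is L2a _ then true else false.
Definition in_b (i : 'I_#|{: L}|) := if enum_val i is L2b _ then true else false.

(** Comparable pairs contribute the generator 0; an incomparable pair has one
    element in each chain, join t and meet s. *)
Lemma join_meet_ideal_cross (f : {mpoly K[#|{: L}|]}) :
  join_meet_ideal K L f <->
  ideal_gen (cross_gen in_a in_b (enum_rank L2s) (enum_rank L2t)) f.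
Proof.
split; apply: ideal_gen_sub; try exact: ideal_genP.
  have idI := ideal_genP
    (@cross_gen K _ in_a in_b (enum_rank L2s) (enum_rank L2t)).
  have [I0 _ _] := idI.
  have le_gen (x y : L) : (x <= y)%O ->
      lvar K x * lvar K y - lvar K (Order.join x y) * lvar K (Order.meet x y) = 0.
    by move=> xy; rewrite (join_r xy) (meet_l xy) mulrC subrr.
  move=> _ [x [y ->]].
  have [xy|nxy] := boolP (x <= y)%O; first by rewrite le_gen.
  have [yx|nyx] := boolP (y <= x)%O.
    by rewrite joinC meetC (mulrC (lvar K x)) le_gen.
  case: x y nxy nyx => [|i|i|] [|j|j|] //;
    rewrite /Order.le /= -?ltnNge => nxy nyx.
  - by have := ltn_trans nxy nyx; rewrite ltnn.
  - by rewrite (mulrC (lvar K (Order.join _ _))); apply: ideal_gen_in;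
      exists (enum_rank (L2a i)), (enum_rank (L2b j));
      rewrite /in_a /in_b !enum_rankK.
  - rewrite (mulrC (lvar K (Order.join _ _))) (mulrC (lvar K (L2b i)));
    apply: ideal_gen_in;
    by exists (enum_rank (L2a j)), (enum_rank (L2b i));
      rewrite /in_a /in_b !enum_rankK.
  - by have := ltn_trans nxy nyx; rewrite ltnn.
move=> _ [i [j [+ + ->]]]; rewrite /in_a /in_b => ai bj; apply: ideal_gen_in.
exists (enum_val i), (enum_val j); rewrite /cross /lvar !enum_valK.
case: (enum_val i) ai (enum_val j) bj => // i' _ [] // j' _.
by rewrite (mulrC 'X_(enum_rank L2s)).
Qed.

End L2.

Theorem theorem1p1 (K : fieldType) (n1 n2 : nat)
    (hn1 : (1 <= n1)%N) (hn2 : (1 <= n2)%N) :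
  is_radical_ideal (join_meet_ideal K (L2 n1 n2)).
Proof.
split=> [|f]; first exact: ideal_genP.
split=> [[m _ /join_meet_ideal_cross fm]|If]; last by exists 1; rewrite ?expr1.
apply/join_meet_ideal_cross; move: fm.
refine (@cross_radical K _ (@in_a _ _) (@in_b _ _) _ _ (enum_rank (L2a (Ordinal hn1)))
          (enum_rank (L2b (Ordinal hn2))) _ _ _ _ _ _ _ _ _ _).
- by move=> i; rewrite /in_a /in_b; case: (enum_val i).
- by rewrite /in_a enum_rankK.
- by rewrite /in_b enum_rankK.
- by rewrite /in_a enum_rankK.
- by rewrite /in_b enum_rankK.
- by rewrite (inj_eq enum_rank_inj).
- by rewrite /in_a enum_rankK.
- by rewrite /in_b enum_rankK.
Qed.
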